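(* Let $(\mathfrak{g},\kappa)$ be a euclidean Lie algebra, $D$ a continuous $\kappa$-skew-symmetric derivation of $\mathfrak{g}$, and let $\hat{\mathfrak{g}}$ be the corresponding Lorentzian double extension with invariant Lorentzian form $\beta$. Let $W=\{\mathbf{x}=(z,x,t)\in\hat{\mathfrak{g}}:t>0,\ \beta(\mathbf{x},\mathbf{x})>0\}$ and $\mathbf{c}=(1,0,0)$. Then the following assertions hold: (a) $\Omega:=W-\mathbb{R}_+\mathbf{c}=\{(z,x,t):t>0\}$ is an open invariant half space bounded by the hyperplane ideal $\tilde{\mathfrak{g}}=\mathbb{R}\mathbf{c}+\mathfrak{g}$. (b) For each $\mathbf{x}\in\Omega$, we have $\mathbf{x}\in\mathrm{Ext}(\overline{\mathrm{conv}}(\mathcal{O}_{\mathbf{x}}))$. (c) If $\lambda=(z^*,\alpha,t^* )\in\hat{\mathfrak{g}}^\beta$ with $z^*>0$ and $\mathbf{x}=(z,x,t)$ with $t>0$, then $\lambda(\mathcal{O}_{\mathbf{x}})=\mathcal{O}_\lambda(\mathbf{x})$ is bounded from below. (d) $W^\star$ is contained in the $\beta$-dual $\hat{\mathfrak{g}}^\beta$ of $\hat{\mathfrak{g}}$. (e) If $\lambda\in\hat{\mathfrak{g}}^\beta$ satisfies $\lambda(\mathbf{c})=z^*\neq0$, then its orbit $\mathcal{O}_\lambda$ is semi-equicontinuous.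
   Context: A euclidean Lie algebra $(\mathfrak{g},\kappa)$ is a locally convex Lie algebra $\mathfrak{g}$ with a continuous positive definite invariant symmetric bilinear form $\kappa$ ($\kappa([x,y],z)=\kappa(x,[y,z])$). $D$ is $\kappa$-skew-symmetric if $\kappa(Dx,y)+\kappa(x,Dy)=0$. The double extension is $\hat{\mathfrak{g}}=\mathbb{R}\times\mathfrak{g}\times\mathbb{R}$ with bracket $[(z,x,t),(z',x',t')]=(\omega(x,x'),\,[x,x']+tDx'-t'Dx,\,0)$, $\omega(x,y)=\kappa(x,Dy)$, and $\beta((z,x,t),(z',x',t'))=zt'+tz'-\kappa(x,x')$ is an invariant Lorentzian form on it. Let $G$ be a connected Lie group with Lie algebra $\mathfrak{g}$ with a smooth action $\alpha^G:\mathbb{R}\to\mathrm{Aut}(G)$ whose derived action on $\mathfrak{g}$ is generated by $D$; the group $G^\sharp=G\rtimes_{\alpha^G}\mathbb{R}$ (whose Lie algebra is $\mathfrak{g}\rtimes_D\mathbb{R}\cong\hat{\mathfrak{g}}/\mathbb{R}\mathbf{c}$) acts on $\hat{\mathfrak{g}}$ by the adjoint action $\mathrm{Ad}$, which preserves $\beta$ and $\mathbf{c}$ and the coordinate $t$. Invariance, the orbits $\mathcal{O}_{\mathbf{x}}=\mathrm{Ad}(G^\sharp)\mathbf{x}$ and $\mathcal{O}_\lambda=\{\lambda\circ\mathrm{Ad}(g):g\in G^\sharp\}\subseteq\hat{\mathfrak{g}}'$ refer to this action; $\mathcal{O}_\lambda(\mathbf{x})=\{\mu(\mathbf{x}):\mu\in\mathcal{O}_\lambda\}$.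 Continuous functionals are written $\lambda=(z^*,\alpha,t^* )$, $\lambda(z,x,t)=z^*z+\alpha(x)+t^*t$, $\alpha\in\mathfrak{g}'$. The $\beta$-dual $\hat{\mathfrak{g}}^\beta\subseteq\hat{\mathfrak{g}}'$ consists of those $\lambda$ for which $\alpha=\lambda|_{\mathfrak{g}}$ is continuous with respect to the norm $\|x\|=\sqrt{\kappa(x,x)}$. $W^\star=\{\lambda\in\hat{\mathfrak{g}}':\lambda|_W\ge0\}$, $\mathbb{R}_+=[0,\infty)$, $\mathrm{Ext}$ denotes the set of extreme points. A subset $C$ of the dual is semi-equicontinuous if $\sup_{\mu\in C}\mu(\cdot)$ is bounded on some non-empty open set. *)

(* Defs.v *)
From HB Require Import structures.
From mathcomp Require Import all_boot all_order all_algebra.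
From mathcomp Require Import all_classical all_reals all_analysis.

Set Implicit Arguments.
Unset Strict Implicit.
Unset Printing Implicit Defensive.

Import Order.TTheory GRing.Theory Num.Theory.
Import numFieldNormedType.Exports.

Local Open Scope classical_set_scope.
Local Open Scope ring_scope.

(* Calculus in locally convex spaces, in the sense of Michal-Bastiani:
   C^{k+1} means continuous, with directional derivatives forming a map
   (x, v) |-> df(x, v) on U x E which is C^k. The library's [derive] is
   restricted to normed spaces. *)
Section Calculus.
Context {R : realType}.

Definition is_dird {E F : tvsType R} (f : E -> F) (x v : E) (l : F) : Prop :=
  (fun h : R => h^-1 *: (f (x + h *: v) - f x)) @ 0^' --> l.

Definition dird {E F : tvsType R} (f : E -> F) (x v : E) : F :=
  xget 0 [set l | is_dird f x v l].

(* To be used with U open. *)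
Fixpoint Ck (k : nat) {E F : tvsType R} (U : set E) (f : E -> F) : Prop :=
  (forall x, U x -> {for x, continuous f}) /\
  if k is k'.+1 then
    (forall x v, U x -> is_dird f x v (dird f x v)) /\
    @Ck k' (E * E)%type F (U `*` setT) (fun p => dird f p.1 p.2)
  else True.

Definition smooth_on {E F : tvsType R} (U : set E) (f : E -> F) : Prop :=
  forall k, Ck k U f.

End Calculus.

Section Manifolds.
Context {R : realType}.

(* [chart_fun] and [chart_inv] are relevant on [chart_dom] and [chart_cod]. *)
Record chart (E : tvsType R) (M : topologicalType) := Chart {
  chart_dom : set M;
  chart_cod : set E;
  chart_fun :> M -> E;
  chart_inv : E -> M;
  chart_dom_open : open chart_dom;
  chart_cod_open : open chart_cod;
  chart_funK : forall m, chart_dom m ->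
    chart_cod (chart_fun m) /\ chart_inv (chart_fun m) = m;
  chart_invK : forall p, chart_cod p ->
    chart_dom (chart_inv p) /\ chart_fun (chart_inv p) = p;
  chart_fun_cont : forall m, chart_dom m -> {for m, continuous chart_fun};
  chart_inv_cont : forall p, chart_cod p -> {for p, continuous chart_inv} }.

Definition is_atlas {E : tvsType R} {M : topologicalType}
    (A : set (chart E M)) : Prop :=
  (forall m, exists2 phi, A phi & chart_dom phi m) /\
  (forall phi psi, A phi -> A psi ->
     smooth_on (chart_cod phi `&` chart_inv phi @^-1` chart_dom psi)
               (psi \o chart_inv phi)).

Definition smooth_map {E F : tvsType R} {M N : topologicalType}
    (A : set (chart E M)) (B : set (chart F N)) (f : M -> N) : Prop :=
  continuous f /\
  forall phi psi, A phi -> B psi ->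
    smooth_on (chart_cod phi `&` (f \o chart_inv phi) @^-1` chart_dom psi)
              (psi \o f \o chart_inv phi).

Program Definition id_chart (E : tvsType R) : chart E E :=
  @Chart E E setT setT id id openT openT _ _ _ _.
Next Obligation. by []. Qed.
Next Obligation. by []. Qed.
Next Obligation. by move=> E m _; exact: cvg_id. Qed.
Next Obligation. by move=> E m _; exact: cvg_id. Qed.

Definition model_atlas (E : tvsType R) : set (chart E E) := [set id_chart E].

Lemma open_setX {M N : topologicalType} (A : set M) (B : set N) :
  open A -> open B -> open (A `*` B).
Proof.
move=> oA oB; rewrite openE => -[x y] [/= Ax By].
by exists (A, B); [split; exact: open_nbhs_nbhs|].
Qed.

Lemma continuous_prod_map {M N P Q : topologicalType} (f : M -> P) (g : N -> Q)
    (x : M * N) : {for x.1, continuous f} -> {for x.2, continuous g} ->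
  {for x, continuous (fun y : M * N => (f y.1, g y.2))}.
Proof.
move=> fx gx; apply: cvg_pair => /=.
- exact: (@continuous_comp _ _ _ fst f x cvg_fst fx).
- exact: (@continuous_comp _ _ _ snd g x cvg_snd gx).
Qed.

Program Definition prod_chart {E F : tvsType R} {M N : topologicalType}
    (phi : chart E M) (psi : chart F N) : chart (E * F)%type (M * N)%type :=
  @Chart (E * F)%type (M * N)%type
    (chart_dom phi `*` chart_dom psi) (chart_cod phi `*` chart_cod psi)
    (fun m => (phi m.1, psi m.2))
    (fun p => (chart_inv phi p.1, chart_inv psi p.2)) _ _ _ _ _ _.
Next Obligation.
move=> E F M N phi psi; apply: open_setX; exact: chart_dom_open.
Qed.
Next Obligation.
move=> E F M N phi psi; apply: open_setX; exact: chart_cod_open.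
Qed.
Next Obligation.
move=> E F M N phi psi [m n] [/= /chart_funK[? ->] /chart_funK[? ->]].
by [].
Qed.
Next Obligation.
move=> E F M N phi psi [m n] [/= /chart_invK[? ->] /chart_invK[? ->]].
by [].
Qed.
Next Obligation.
move=> E F M N phi psi m [m1 m2]; apply: continuous_prod_map;
  exact: chart_fun_cont.
Qed.
Next Obligation.
move=> E F M N phi psi m [m1 m2]; apply: continuous_prod_map;
  exact: chart_inv_cont.
Qed.

Definition prod_atlas {E F : tvsType R} {M N : topologicalType}
    (A : set (chart E M)) (B : set (chart F N)) :
    set (chart (E * F)%type (M * N)%type) :=
  [set prod_chart phi psi | phi in A & psi in B].

End Manifolds.

Arguments model_atlas {R} E _.

(* No compatibility is required here: in [lieGroup] it follows from
   smoothness of the operations. *)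
#[short(type="preTopologicalGroupType")]
HB.structure Definition PreTopologicalGroup := {G of Group G & Topological G}.

Section LieTheory.
Context {R : realType}.

Record lcLieAlgebra := LcLieAlgebra {
  lie_car :> tvsType R;
  lie : {bilinear lie_car -> lie_car -> lie_car};
  lie_alt : forall x, lie x x = 0;
  lie_jacobi : forall x y z,
    lie x (lie y z) + lie y (lie z x) + lie z (lie x y) = 0;
  lie_cont : continuous (fun p : lie_car * lie_car => lie p.1 p.2) }.
Arguments lie {_}.

(* The underlying space is automatically Hausdorff, since kappa is continuous
   and positive definite. *)
Record euclideanLieAlgebra := EuclideanLieAlgebra {
  euc_lie :> lcLieAlgebra;
  kappa : {biscalar euc_lie};
  kappa_sym : forall x y, kappa x y = kappa y x;
  kappa_pos : forall x, x != 0 -> 0 < kappa x x;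
  kappa_inv : forall x y z, kappa (lie x y) z = kappa x (lie y z);
  kappa_cont : continuous (fun p : euc_lie * euc_lie => kappa p.1 p.2) }.
Arguments kappa {_}.

Definition skew_derivation {g : euclideanLieAlgebra} (D : {linear g -> g}) :=
  [/\ continuous D,
      forall x y, D (lie x y) = lie (D x) y + lie x (D y) &
      forall x y, kappa (D x) y + kappa x (D y) = 0].

(* The left invariant vector field with value x at 1, in the chart phi. *)
Definition left_field {E : tvsType R} {G : preTopologicalGroupType}
    (phi : chart E G) (x : E) (p : E) : E :=
  dird (fun q => phi (chart_inv phi p * chart_inv phi q)%g) (phi 1%g) x.

(* A locally convex Lie group with Lie algebra g. The tangent space at 1 is
   identified with g through the differential at 1 of the chart [lg_chart1];
   the bracket at 1 of the vector fields X = left_field x, Y = left_field y is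
   dY(X) - dX(Y). *)
Record lieGroup (g : lcLieAlgebra) := LieGroup {
  lg_car :> preTopologicalGroupType;
  lg_atlas : set (chart g lg_car);
  lg_hausdorff : hausdorff_space lg_car;
  lg_atlasP : is_atlas lg_atlas;
  lg_mul_smooth : smooth_map (prod_atlas lg_atlas lg_atlas) lg_atlas
    (fun p : lg_car * lg_car => (p.1 * p.2)%g);
  lg_inv_smooth : smooth_map lg_atlas lg_atlas (fun a : lg_car => a^-1%g);
  lg_chart1 : chart g lg_car;
  lg_chart1_atlas : lg_atlas lg_chart1;
  lg_chart1_dom : chart_dom lg_chart1 1%g;
  lg_lie : forall x y : g, lie x y =
    dird (left_field lg_chart1 y) (lg_chart1 1%g) x -
    dird (left_field lg_chart1 x) (lg_chart1 1%g) y }.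

Arguments lg_atlas {g} _ _.

Definition derived_auto {g : lcLieAlgebra} {G : lieGroup g} (f : G -> G)
    (x : g) : g :=
  dird (fun p => lg_chart1 G (f (chart_inv (lg_chart1 G) p)))
       (lg_chart1 G 1%g) x.

Definition smooth_aut_action {g : lcLieAlgebra} {G : lieGroup g}
    (a : R -> G -> G) :=
  [/\ forall h, a 0 h = h,
      forall s t h, a (s + t) h = a s (a t h),
      forall s h k, a s (h * k)%g = (a s h * a s k)%g &
      smooth_map (prod_atlas (model_atlas R) (lg_atlas G)) (lg_atlas G)
        (fun p : R * G => a p.1 p.2)].

Definition generated_by {g : lcLieAlgebra} {G : lieGroup g}
    (a : R -> G -> G) (D : g -> g) :=
  forall x : g, is_dird (fun s : R => derived_auto (a s) x) 0 1 (D x).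

(* Multiplication of the semidirect product of G and R, carried by G * R. *)
Definition semidirect_mul {g : lcLieAlgebra} {G : lieGroup g}
    (a : R -> G -> G) (h k : G * R) : G * R :=
  ((h.1 * a h.2 k.1)%g, h.2 + k.2).

End LieTheory.

Arguments lie {R _}.
Arguments kappa {R _}.
Arguments lg_atlas {R g} _ _.
Arguments lcLieAlgebra : clear implicits.
Arguments euclideanLieAlgebra : clear implicits.

(* An element (z, x, t) of the double extension is ((z, x), t), of components
   u.1.1, u.1.2 and u.2. *)
Notation dext R g := (R * lie_car (euc_lie g) * R)%type.

Section DoubleExtension.
Context {R : realType} {g : euclideanLieAlgebra R}.
Implicit Types (D : {linear g -> g}) (u v : dext R g).

Definition dext_bracket D u v : dext R g :=
  (kappa u.1.2 (D v.1.2),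
   lie u.1.2 v.1.2 + u.2 *: D v.1.2 - v.2 *: D u.1.2,
   0).

Definition dext_form u v : R :=
  u.1.1 * v.2 + u.2 * v.1.1 - kappa u.1.2 v.1.2.

Definition dext_c : dext R g := (1, 0, 0).

Definition dext_functional (zs : R) (al : g -> R) (ts : R) (u : dext R g) : R :=
  zs * u.1.1 + al u.1.2 + ts * u.2.

(* The adjoint action on the double extension of the semidirect product of G
   and R, whose Lie algebra is the quotient by R c: the smooth linear action
   whose derived action is the adjoint representation, the tangent vector
   (v, s) at the identity acting by bracketing with the representative
   (0, v, s). As the group is connected, there is only one such action. *)
Definition adjoint_action D {G : lieGroup g} (a : R -> G -> G)
    (Ad : G * R -> dext R g -> dext R g) :=
  [/\ (forall u, Ad (1%g, 0) u = u) /\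
      (forall h k u, Ad (semidirect_mul a h k) u = Ad h (Ad k u)),
      forall h, linear (Ad h),
      smooth_map
        (prod_atlas (prod_atlas (lg_atlas G) (model_atlas R))
                    (model_atlas (dext R g)))
        (model_atlas (dext R g)) (fun p : (G * R) * dext R g => Ad p.1 p.2) &
      forall (v : g) (s : R) (u : dext R g),
        is_dird (fun p : g * R => Ad (chart_inv (lg_chart1 G) p.1, p.2) u)
                (lg_chart1 G 1%g, 0) (v, s) (dext_bracket D (0, v, s) u)].

Definition topological_dual (E : tvsType R) : set (E -> R) :=
  [set f | linear f /\ continuous f].

Definition kappa_norm (x : g) : R := Num.sqrt (kappa x x).

Definition kappa_continuous (al : g -> R) :=
  forall x e, 0 < e -> exists2 d, 0 < d &
    forall y, kappa_norm (y - x) < d -> `|al y - al x| < e.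

Definition beta_dual : set (dext R g -> R) :=
  [set lam | topological_dual lam /\ kappa_continuous (fun x => lam (0, x, 0))].

Definition coneW : set (dext R g) :=
  [set u | 0 < u.2 /\ 0 < dext_form u u].

Definition Omega : set (dext R g) :=
  [set w - r *: dext_c | w in coneW & r in [set r : R | 0 <= r]].

Definition gtilde : set (dext R g) :=
  [set r *: dext_c + (0, x, 0) | r in [set: R] & x in [set: g]].

Definition is_ideal D (I : set (dext R g)) :=
  [/\ I 0,
      forall (r : R) u v, I u -> I v -> I (r *: u + v) &
      forall u v, I v -> I (dext_bracket D u v)].

Section Action.
Variables (G : lieGroup g) (Ad : G * R -> dext R g -> dext R g).

Definition invariant_set (S : set (dext R g)) :=
  forall h u, S u -> S (Ad h u).

Definition orbit_pt (u : dext R g) : set (dext R g) :=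
  [set Ad h u | h in [set: G * R]].

Definition orbit_fun (lam : dext R g -> R) : set (dext R g -> R) :=
  [set lam \o Ad h | h in [set: G * R]].

End Action.

End DoubleExtension.

Arguments topological_dual {R} E _.
Arguments coneW {R} g _.
Arguments Omega {R} g _.
Arguments gtilde {R} g _.
Arguments beta_dual {R} g _.

Section Convexity.
Context {R : realType} {E : tvsType R}.
Implicit Types C S H : set E.

Definition is_open_half_space_bounded_by S H :=
  exists f : E -> R, [/\ topological_dual E f, exists u, f u != 0,
    S = [set u | 0 < f u] & H = [set u | f u = 0]].

Definition closed_convex_hull C : set E := closure (smallest (@convex_set R E) C).

Definition extreme_points C : set E :=
  [set x | C x /\ forall y z (s : R), C y -> C z -> 0 < s < 1 ->
     x = s *: y + (1 - s) *: z -> y = x /\ z = x].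

Definition dual_cone C : set (E -> R) :=
  [set f | topological_dual E f /\ forall u, C u -> 0 <= f u].

Definition semi_equicontinuous (F : set (E -> R)) :=
  F `<=` topological_dual E /\
  exists U : set E, [/\ open U, U !=set0 &
    exists M : R, forall u, U u ->
      (`|ereal_sup [set (f u)%:E | f in F]| <= M%:E)%E].

End Convexity.

(* Main.v *)
Require Import Defs.
From HB Require Import structures.
From mathcomp Require Import all_boot all_order all_algebra.
From mathcomp Require Import ring lra.
From mathcomp Require Import all_classical all_reals all_analysis.

Set Implicit Arguments.
Unset Strict Implicit.
Unset Printing Implicit Defensive.

Import Order.TTheory GRing.Theory Num.Theory.
Import numFieldNormedType.Exports.

Local Open Scope classical_set_scope.
Local Open Scope ring_scope.

(** Everything rests on two conserved quantities: the adjoint action preserves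
    the coordinate t and the value of the Lorentzian form
    beta(u, u) = 2 z t - kappa(x, x)
    ([Ad_t] and [Ad_form]). Both are annihilated by every vector field
    u |-> [(0, v, s), u]: the last coordinate of a bracket is 0, and beta is
    invariant, which is the skew-symmetry of D together with the invariance of
    kappa. To integrate this infinitesimal invariance to the group
    ([conserved_quantity_invariant]), only real-valued calculus is needed.
    The orbit function of a conserved quantity has derivative 0 at the identity,
    hence at every point of the chart at 1, because a right translation carries
    that point to 1 at the cost of replacing u by another point of its orbit.
    By the mean value theorem it is constant on a convex neighbourhood of 1, so
    the elements of G that preserve the quantity form an open subgroup, which
    is all of the connected group G. The factor R is a one-parameter group.

    So the orbit of u lies in the hyperboloid of all w = (z', x', t) with the
    same t and with beta(w, w) = beta(u, u). When t is not 0 this is the graph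
    z' = (beta(u, u) + kappa(x', x')) / (2 t) of a quadratic function of x'.
    For t > 0 the closed convex set
    {w | w has last coordinate t and beta(u, u) <= beta(w, w)}
    is the region above this graph. Since kappa is positive definite, the graph
    is strictly convex, so each of its points is an extreme point of the region,
    and a fortiori of the closed convex hull of the orbit ([orbit_extreme]);
    this is (b).
    A functional lambda(z, x, t) = c z + alpha(x) + s t with
    |alpha(x)| <= M ||x|| becomes on the graph a quadratic function of x' with
    leading term c ||x'||^2 / (2 t) and linear part bounded by M ||x'||.
    Completing the square bounds it below when c t > 0
    ([functional_lower_bound]), hence (c); replacing lambda by - lambda bounds
    it above when c t < 0, by a constant depending continuously on t and
    beta(u, u), hence (e).
    For (d), the points (1, x, 1) with kappa(x, x) <= 1 belong to W; positivity
    of lambda at x and at - x bounds alpha on the unit ball. *)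

(** * Directional derivatives and the mean value theorem *)

Section DirectionalDerivatives.
Context {R : realType}.
Implicit Types (E F : tvsType R).

(** Local convexity in the form used with the mean value theorem: segments
    issued from x stay in the neighbourhood. *)
Lemma near_convex E (x : E) (U : set E) : nbhs x U ->
  exists V : set E, [/\ nbhs x V, V `<=` U & forall y (s : R), V x -> V y ->
    0 <= s <= 1 -> V (x + s *: (y - x))].
Proof.
have [B Bconv [Bopen Bbasis]] := @locally_convex R E.
move=> /Bbasis[V [BV Vx] VU]; exists V; split=> //.
  by apply: open_nbhs_nbhs; split=> //; exact: Bopen.
move=> y s _ Vy /andP[s0 s1].
have := Bconv V (mem_set BV) y x (Itv01 s0 s1) (mem_set Vy) (mem_set Vx).
rewrite inE; congr V.
rewrite /conv/= /unstable.onem scalerBl scale1r scalerBr.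
by rewrite addrCA.
Qed.

Lemma tvs_cvgD E (T : Type) (F : set_system T) {FF : Filter F}
    (f f' : T -> E) (x x' : E) :
  f @ F --> x -> f' @ F --> x' -> (fun t => f t + f' t) @ F --> x + x'.
Proof.
move=> fx f'x'; exact: (continuous2_cvg _ (@tvs.add_continuous E (x, x'))).
Qed.

Lemma tvs_cvgZ E (T : Type) (F : set_system T) {FF : Filter F}
    (k : T -> R) (f : T -> E) (r : R) (x : E) :
  k @ F --> r -> f @ F --> x -> (fun t => k t *: f t) @ F --> r *: x.
Proof.
move=> kr fx.
have H := @tvs.scale_continuous R E (r, x).
have P : (fun t => (k t, f t)) @ F --> nbhs ((r, x) : R^o * E) .
  apply: (@cvg_pair _ _ _ _ (nbhs (r : R^o)) (nbhs x)) => //.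
exact: cvg_comp P H.
Qed.

Lemma tvs_cvg_pair E F (T : Type) (S : set_system T) {FS : Filter S}
    (f : T -> E) (f' : T -> F) (x : E) (x' : F) :
  f @ S --> x -> f' @ S --> x' -> (fun t => (f t, f' t)) @ S --> (x, x').
Proof. exact: cvg_pair. Qed.

Lemma tvs_fst_continuous E F : continuous (@fst E F).
Proof. by move=> x; exact: (@cvg_fst E F (nbhs x.1) (nbhs x.2)). Qed.

Lemma tvs_snd_continuous E F : continuous (@snd E F).
Proof. by move=> x; exact: (@cvg_snd E F (nbhs x.1) (nbhs x.2)). Qed.

Lemma slice_continuous E F F' (y : F) (z : F') :
  continuous (fun x : E => ((x, y), z)).
Proof.
move=> x; apply: (@tvs_cvg_pair (E * F)%type F'); last exact: cvg_cst.
by apply: tvs_cvg_pair; [exact: cvg_id|exact: cvg_cst].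
Qed.

Lemma line_cvg E (x v : E) (s : R) :
  (fun t : R => x + t *: v) @ s --> x + s *: v.
Proof.
apply: tvs_cvgD; first exact: cvg_cst.
by apply: tvs_cvgZ; [exact: cvg_id|exact: cvg_cst].
Qed.

(** Directional differentiability gives continuity only along the given line,
    which suffices for the product and chain rules below. *)
Lemma is_dird_cvg E F (f : E -> F) (x v : E) (l : F) : is_dird f x v l ->
  f (x + h *: v) @[h --> (0:R)^'] --> f x.
Proof.
move=> fl.
have H : (fun h : R => f x + h *: (h^-1 *: (f (x + h *: v) - f x)))
    @ (0:R)^' --> f x.
  rewrite -[X in _ --> X]addr0 -(scale0r l).
  apply: tvs_cvgD; first exact: cvg_cst.
  by apply: tvs_cvgZ => //; exact: cvg_within.
apply: cvg_trans H; apply: near_eq_cvg.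
near=> h.
have h0 : h != 0 by near: h; exact: nbhs_dnbhs_neq.
by rewrite scalerA divff// scale1r addrC subrK.
Unshelve. all: by end_near.
Qed.

Lemma is_dird_derive E (f : E -> R) (x v : E) (s l : R) :
  is_dird f (x + s *: v) v l -> is_derive s 1 (fun t => f (x + t *: v)) l.
Proof.
rewrite /is_dird => H.
have {}H : (fun h =>
    h^-1 *: (((fun t => f (x + t *: v)) \o shift s) (h *: (1:R))
      - f (x + s *: v))) @ (0:R)^' --> l.
  apply: cvg_trans H; apply: near_eq_cvg; apply: nearW => h /=.
  by rewrite scaler1 (addrC h) scalerDl addrA.
split; first by apply/cvg_ex; exists l.
exact: cvg_lim.
Qed.

Lemma is_dird_affine E E' F (f : E' -> F) (j : E -> E') (x v : E) (w : E')
    (l : F) : (forall h : R, j (x + h *: v) = j x + h *: w) ->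
  is_dird f (j x) w l -> is_dird (f \o j) x v l.
Proof.
move=> jE; rewrite /is_dird.
have -> // : (fun h : R => h^-1 *: (f (j x + h *: w) - f (j x))) =
  (fun h => h^-1 *: ((f \o j) (x + h *: v) - (f \o j) x)).
by apply/funext => h; rewrite /= jE.
Qed.

Lemma is_dird_near E F (f f' : E -> F) (x v : E) (l : F) :
  f x = f' x -> (\forall h \near (0:R)^', f (x + h *: v) = f' (x + h *: v)) ->
  is_dird f x v l -> is_dird f' x v l.
Proof.
move=> ff' ffn; rewrite /is_dird => H; apply: cvg_trans H; apply: near_eq_cvg.
by apply: filterS ffn => h ->; rewrite ff'.
Qed.

Lemma is_dird_unique E (f : E -> R) (x v : E) (l l' : R) :
  is_dird f x v l -> is_dird f x v l' -> l = l'.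
Proof. by move=> /cvg_lim <- // /cvg_lim <-. Qed.

(** The step h may have either sign, as it does in a two-sided limit. *)
Lemma mvt_from0 (k dk : R -> R) (h : R) :
  (forall s, 0 <= s <= 1 -> is_derive (s * h) 1 k (dk (s * h))) ->
  exists2 s, 0 <= s <= 1 & k h - k 0 = dk (s * h) * h.
Proof.
move=> dkP; have [->|h0] := eqVneq h 0.
  by exists 0; rewrite ?lexx ?ler01// subrr mulr0.
have dkP' c : 0 <= c / h <= 1 -> is_derive c 1 k (dk c).
  by move=> /dkP; rewrite divfK.
have [hlt|hgt|/eqP] := ltgtP h 0; last by rewrite (negPf h0).
- have ci c : c \in `[h, 0] -> 0 <= c / h <= 1.
    rewrite in_itv/= => /andP[hc c0].
    rewrite ler_ndivlMr// mul0r c0/= ler_ndivrMr//.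
    by rewrite mul1r.
  have [c|| c ch E] := @MVT_segment _ k dk h 0 (ltW hlt).
  + by move=> ch; apply/dkP'/ci; move: ch; exact: subset_itv_oo_cc.
  + apply: derivable_within_continuous => c /ci/dkP' ?; exact: ex_derive.
  + exists (c / h); first exact: ci.
    by rewrite divfK// -[LHS]opprB E sub0r mulrN opprK.
- have ci c : c \in `[0, h] -> 0 <= c / h <= 1.
    rewrite in_itv/= => /andP[c0 ch].
    by rewrite (divr_ge0 c0 (ltW hgt))/= ler_pdivrMr// mul1r.
  have [c|| c ch E] := @MVT_segment _ k dk 0 h (ltW hgt).
  + by move=> ch; apply/dkP'/ci; move: ch; exact: subset_itv_oo_cc.
  + apply: derivable_within_continuous => c /ci/dkP' ?; exact: ex_derive.
  + exists (c / h); first exact: ci.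
    by rewrite divfK// E subr0.
Qed.

(** Chain rule for a real-valued outer function. Writing eta (x + h v) as
    eta x + h q_h with q_h tending to l, the mean value theorem along the
    segment from eta x in direction q_h reduces the quotient to df at a nearby
    point and direction, and joint continuity of df concludes. Having real
    values spares the Hahn-Banach argument that a vector-valued outer function
    would need. *)
Lemma is_dird_comp E F (f : F -> R) (df : F * F -> R) (U : set F)
    (eta : E -> F) (x v : E) (l : F) :
  nbhs (eta x) U -> (forall y w, U y -> is_dird f y w (df (y, w))) ->
  {for (eta x, l), continuous df} -> is_dird eta x v l ->
  is_dird (f \o eta) x v (df (eta x, l)).
Proof.
move=> oU fdf cdf etav; apply/cvgrPdist_lt => e e0.
move/cvgrPdist_lt: cdf => /(_ e e0)[[A B] /= [Ax Bv] AB].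
have [V [Vx VAU Vconv]] := near_convex (filterI Ax oU).
have etaV : \forall h \near (0:R)^', V (eta (x + h *: v)).
  by apply: (is_dird_cvg etav); exact: Vx.
have qB : \forall h \near (0:R)^', B (h^-1 *: (eta (x + h *: v) - eta x)).
  exact: etav.
near=> h.
have h0 : h != 0 by near: h; exact: nbhs_dnbhs_neq.
have Bq : B (h^-1 *: (eta (x + h *: v) - eta x)) by near: h.
have Vh : V (eta (x + h *: v)) by near: h.
set q := h^-1 *: (eta (x + h *: v) - eta x) in Bq *.
have hq : h *: q = eta (x + h *: v) - eta x by rewrite scalerA divff// scale1r.
have Vs c : 0 <= c <= 1 -> V (eta x + (c * h) *: q).
  move=> c01; rewrite -scalerA hq; apply: Vconv => //; exact: nbhs_singleton.
have [|c /Vs Vc] := @mvt_from0 (fun t => f (eta x + t *: q))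
    (fun t => df (eta x + t *: q, q)) h.
  by move=> c /Vs Vc; apply: is_dird_derive; apply: fdf; exact: (VAU _ Vc).2.
rewrite scale0r addr0 hq [eta x + _]addrC subrK => E1.
rewrite /= E1 mulrC /GRing.scale/= mulKf//.
by apply: AB; split=> //=; exact: (VAU _ Vc).1.
Unshelve. all: by end_near.
Qed.

End DirectionalDerivatives.

(** * Translations and generation in a connected Lie group *)

Section LieGroups.
Context {R : realType} {g : lcLieAlgebra R} (G : lieGroup g).

Lemma chart_inv1 : chart_inv (lg_chart1 G) (lg_chart1 G 1%g) = 1%g.
Proof. by have [] := chart_funK (lg_chart1_dom G). Qed.

Lemma chart_cod1 : chart_cod (lg_chart1 G) (lg_chart1 G 1%g).
Proof. by have [] := chart_funK (lg_chart1_dom G). Qed.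

Lemma lg_mulg_continuous (h : G) : continuous (fun k : G => (h * k)%g).
Proof.
move=> k.
apply: (@continuous_comp G (G * G)%type G (fun k => (h, k))
  (fun p => (p.1 * p.2)%g)).
  by apply: cvg_pair; [exact: cvg_cst|exact: cvg_id].
exact: (lg_mul_smooth G).1.
Qed.

(** A subgroup containing a neighbourhood of 1 is open, and closed since its
    complement is a union of cosets. *)
Lemma connected_subgroup_ind (S U : set G) : connected [set: G] ->
  S 1%g -> (forall h k, S h -> S k -> S (h * k)%g) ->
  (forall h, S h -> S (h^-1)%g) -> nbhs (1%g : G) U -> U `<=` S ->
  forall h, S h.
Proof.
move=> Gc S1 SM SV U1 US h.
have Unbhs k : \forall m \near (k : G), U (k^-1 * m)%g.
  by apply: (@lg_mulg_continuous k^-1%g k); rewrite mulVg.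
suff -> : S = [set: G] by [].
apply: Gc; first by exists 1%g.
- exists S; last by rewrite setTI.
  rewrite openE => k Sk; apply: filterS (Unbhs k) => m /US Skm.
  by rewrite -(mulVKg k m); exact: SM.
- exists S; last by rewrite setTI.
  rewrite -[S]setCK; apply: open_closedC; rewrite openE => k Sk.
  apply: filterS (Unbhs k) => m /US Skm Sm; apply: Sk.
  have -> : k = (m * (k^-1 * m)^-1)%g by rewrite invgM invgK mulVKg.
  by apply: SM => //; exact: SV.
Qed.

(** Right translation by k^-1 moves k to 1. It is read in the chart at 1 on both
    sides, although k^-1 itself may only be covered by another chart psi. *)
Lemma is_dird_right_translation (x v : g) : chart_cod (lg_chart1 G) x ->
  let k := chart_inv (lg_chart1 G) x in
  let eta p := lg_chart1 G (chart_inv (lg_chart1 G) p * k^-1)%g in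
  exists l, is_dird eta x v l.
Proof.
set phi := lg_chart1 G => Ux k eta.
have [psi Apsi psik] := (lg_atlasP G).1 (k^-1)%g.
have [mc msm] := lg_mul_smooth G.
have Aphi := lg_chart1_atlas G.
pose M (p : g * g) := phi (chart_inv phi p.1 * chart_inv psi p.2)%g.
have MC1 : Ck 1 [set p : g * g | (chart_cod phi p.1 /\ chart_cod psi p.2) /\
    chart_dom phi (chart_inv phi p.1 * chart_inv psi p.2)%g] M.
  apply: (msm (prod_chart phi psi) phi _ Aphi 1%N).
  by exists phi => //; exists psi.
have [_ [Mdird _]] := MC1.
have [psik1 psik2] := chart_funK psik.
exists (dird M (x, psi k^-1%g) (v, 0)).
have -> : eta = M \o (fun p => (p, psi k^-1%g)).
  by apply/funext => p; rewrite /eta /M /= psik2.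
apply: (@is_dird_affine _ _ _ _ _ _ _ _ (v, 0)).
  by move=> h; congr pair; rewrite /= scaler0 addr0.
apply: Mdird => /=; split; first by split.
by rewrite psik2 mulgV; exact: lg_chart1_dom.
Qed.

End LieGroups.

(** * Conserved quantities of the adjoint action *)

Section Conservation.
Context {R : realType} {g : euclideanLieAlgebra R}.

(** dQ (w, l) is the derivative of Q at w in the direction l, specified by its
    effect along differentiable maps; the last condition is the infinitesimal
    invariance of Q under ad (v, s). *)
Definition conserved_quantity (D : {linear g -> g}) (Q : dext R g -> R)
    (dQ : dext R g * dext R g -> R) :=
  [/\ forall (E : tvsType R) (f : E -> dext R g) (x v : E) (l : dext R g),
        is_dird f x v l -> is_dird (Q \o f) x v (dQ (f x, l)),
      continuous dQ &
      forall v s u, dQ (u, dext_bracket D (0, v, s) u) = 0].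

Variables (D : {linear g -> g}) (G : lieGroup g) (a : R -> G -> G)
  (Ad : G * R -> dext R g -> dext R g).
Hypotheses (hAd : adjoint_action D a Ad).
Variables (Q : dext R g -> R) (dQ : dext R g * dext R g -> R).
Hypothesis hQ : conserved_quantity D Q dQ.

Let phi := lg_chart1 G.

Let A (w : dext R g) (p : g) : dext R g := Ad (chart_inv phi p, 0) w.

(* Smoothness is given for this joint map, of which the orbit maps A w are
   slices. *)
Let hatA (q : (g * R) * dext R g) : dext R g :=
  Ad (chart_inv phi q.1.1, q.1.2) q.2.

Let dA (w : dext R g) (p v : g) : dext R g :=
  dird hatA (p, 0, w) (v, 0, 0).

Let hatA_C1 : Ck 1 [set q : (g * R) * dext R g | chart_cod phi q.1.1] hatA.
Proof.
case: hAd => _ _ [_ sm] _.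
have := sm (prod_chart (prod_chart phi (id_chart R)) (id_chart (dext R g)))
  (id_chart (dext R g)) _ erefl 1%N.
set U := (X in Ck _ X _).
have -> : U = [set q : (g * R) * dext R g | chart_cod phi q.1.1].
  by apply/seteqP; split => [q [[[]]]|q Uq].
apply; exists (prod_chart phi (id_chart R)); last by exists (id_chart (dext R g)).
exists phi; first exact: lg_chart1_atlas.
by exists (id_chart R).
Qed.

Let A_dird w p v : chart_cod phi p -> is_dird (A w) p v (dA w p v).
Proof.
move=> Up; have [_ [Hd _]] := hatA_C1.
have -> : A w = hatA \o (fun p => (p, 0, w)) by [].
apply: (@is_dird_affine _ _ _ _ _ _ _ _ (v, 0, 0)); last exact: Hd.
by move=> h; congr (_, _, _); rewrite /= scaler0 addr0.
Qed.

Let A_cont w p : chart_cod phi p -> {for p, continuous (A w)}.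
Proof.
move=> Up; have [Hc _] := hatA_C1.
apply: (@continuous_comp _ _ _ (fun p => ((p, 0), w) : (g * R) * dext R g) hatA).
  exact: (@slice_continuous R g R (dext R g)).
exact: Hc.
Qed.

Let dA_cont w p v : chart_cod phi p ->
  {for (p, v), continuous (fun q => dA w q.1 q.2)}.
Proof.
move=> Up; have [_ [_ [Hc _]]] := hatA_C1.
apply: (@continuous_comp _ _ _
  (fun q : g * g => (((q.1, 0), w), ((q.2, 0), 0)) :
    ((g * R) * dext R g) * ((g * R) * dext R g))
  (fun q => dird hatA q.1 q.2)); last exact: Hc.
apply: (@tvs_cvg_pair R (g * R * dext R g)%type (g * R * dext R g)%type).
- apply: (@continuous_comp _ _ _ fst (fun y : g => ((y, 0:R), w))).
    exact: cvg_fst.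
  exact: (@slice_continuous R g R (dext R g)).
- apply: (@continuous_comp _ _ _ snd (fun y : g => ((y, 0:R), 0 : dext R g))).
    exact: cvg_snd.
  exact: (@slice_continuous R g R (dext R g)).
Qed.

Let df w (q : g * g) : R := dQ (A w q.1, dA w q.1 q.2).

Let df_cont w p v : chart_cod phi p -> {for (p, v), continuous (df w)}.
Proof.
move=> Up; have [_ Hc _] := hQ.
apply: (@continuous_comp _ _ _ (fun q => (A w q.1, dA w q.1 q.2)) dQ);
  last exact: Hc.
apply: (@tvs_cvg_pair R (dext R g) (dext R g)); last exact: dA_cont.
apply: (@continuous_comp _ _ _ fst (A w)); first exact: cvg_fst.
exact: A_cont.
Qed.

Let QA_dird w p v : chart_cod phi p -> is_dird (Q \o A w) p v (df w (p, v)).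
Proof. by move=> Up; have [+ _ _] := hQ; apply; exact: A_dird. Qed.

Let Ad1 w : Ad (1%g, 0) w = w.
Proof. by case: hAd => -[]. Qed.

Let df1 w v : df w (phi 1%g, v) = 0.
Proof.
have [Q1 _ Q0] := hQ; case: hAd => _ _ _ tangent.
suff H : is_dird (Q \o A w) (phi 1%g) v 0.
  exact: (is_dird_unique (QA_dird (chart_cod1 G)) H).
have := Q1 _ _ _ _ _ (tangent v 0 w).
rewrite /= chart_inv1 Ad1 Q0 => H.
have -> : Q \o A w =
  (Q \o (fun p : g * R => Ad (chart_inv phi p.1, p.2) w)) \o (fun p => (p, 0)) by [].
apply: (@is_dird_affine _ _ _ _ _ _ _ _ (v, 0)); last exact: H.
by move=> h; congr pair; rewrite /= scaler0 addr0.
Qed.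

Hypothesis a_action : smooth_aut_action a.

Let AdM h k u : Ad ((h * k)%g, 0) u = Ad (h, 0) (Ad (k, 0) u).
Proof.
case: hAd => -[_ <-] _ _ _; case: a_action => a0 _ _ _.
by rewrite /semidirect_mul/= a0 addr0.
Qed.

(* Near x, the orbit map of u is the orbit map of w = Ad (k, 0) u after the
   right translation of k = chart_inv phi x to 1, where the derivative
   vanishes by df1. *)
Let QA_dird0 u x v : chart_cod phi x -> is_dird (Q \o A u) x v 0.
Proof.
move=> Ux; set k := chart_inv phi x.
have [l] := is_dird_right_translation v Ux; rewrite -/phi -/k.
set eta := (X in is_dird X) => etal.
have [Dx kx] := chart_invK Ux.
have eta1 : eta x = phi 1%g by rewrite /eta mulgV.
set w := Ad (k, 0) u.
have H : is_dird ((Q \o A w) \o eta) x v 0.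
  rewrite -(df1 w l) -eta1.
  apply: (@is_dird_comp _ _ _ _ _ (chart_cod phi)) => //.
  - rewrite eta1; apply: open_nbhs_nbhs.
    by split; [exact: chart_cod_open|exact: chart_cod1].
  - by move=> y z; exact: QA_dird.
  - by rewrite eta1; exact/df_cont/chart_cod1.
have QAE p : chart_dom phi (chart_inv phi p * k^-1)%g ->
    ((Q \o A w) \o eta) p = (Q \o A u) p.
  move=> /chart_funK[_ etaK]; rewrite /= /A /eta etaK.
  by rewrite /w -AdM mulgVK.
apply: is_dird_near H.
- by apply: QAE; rewrite mulgV; exact: lg_chart1_dom.
have near_x : \forall p \near x, chart_dom phi (chart_inv phi p * k^-1)%g.
  have cx : {for x, continuous (fun p => (chart_inv phi p * k^-1)%g)}.
    apply: (@continuous_comp _ _ _ (fun p => (chart_inv phi p, k^-1%g))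
      (fun p : G * G => (p.1 * p.2)%g)); last exact: (lg_mul_smooth G).1.
    by apply: cvg_pair; [exact: chart_inv_cont|exact: cvg_cst].
  apply: cx; rewrite mulgV; apply: open_nbhs_nbhs.
  by split; [exact: chart_dom_open|exact: lg_chart1_dom].
have xv : (fun h : R => x + h *: v) @ (0:R)^' --> x.
  apply: (@cvg_comp _ _ _ id (fun h : R => x + h *: v) _ (nbhs (0:R))).
    exact: cvg_within.
  by have := @line_cvg _ _ x v 0; rewrite scale0r addr0.
near=> h; apply: QAE; near: h; exact: (xv _ near_x).
Unshelve. all: by end_near.
Qed.

Let QA_const : exists2 V : set g, nbhs (phi 1%g) V &
  forall u p, V p -> Q (A u p) = Q u.
Proof.
have [|V [nV VU Vconv]] := @near_convex _ _ (phi 1%g) (chart_cod phi).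
  apply: open_nbhs_nbhs.
  by split; [exact: chart_cod_open|exact: chart_cod1].
exists V => // u p Vp.
have [|s _] := @mvt_from0 _ (fun t => Q (A u (phi 1%g + t *: (p - phi 1%g))))
    (fun=> 0) 1.
  move=> s s01; apply: (@is_dird_derive _ _ (Q \o A u)); apply: QA_dird0.
  by apply/VU/Vconv => //; [exact: nbhs_singleton|rewrite mulr1].
rewrite scale1r scale0r addr0 [phi 1%g + _]addrC subrK mul0r => /eqP.
rewrite subr_eq0 => /eqP->.
by rewrite /A chart_inv1 Ad1.
Qed.

Hypothesis G_connected : connected [set: G].

Let QG h u : Q (Ad (h, 0) u) = Q u.
Proof.
pose S := [set h : G | forall u, Q (Ad (h, 0) u) = Q u].
have [V nV VQ] := QA_const.
suff : forall h, S h by apply.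
apply: (@connected_subgroup_ind _ _ _ S
    [set h | chart_dom phi h /\ V (phi h)]) => //.
- by move=> w; rewrite Ad1.
- by move=> {}h k Sh Sk w; rewrite AdM Sh Sk.
- by move=> {}h Sh w; rewrite -Sh -AdM mulgV Ad1.
- apply: filterI; last exact: (chart_fun_cont (lg_chart1_dom G)).
  apply: open_nbhs_nbhs.
  by split; [exact: chart_dom_open|exact: lg_chart1_dom].
- move=> k [/chart_funK[_ kK] Vk] w.
  by rewrite -{1}kK; exact: VQ.
Qed.

Let Q_R s u : Q (Ad (1%g, s) u) = Q u.
Proof.
case: hAd => -[_ AdMul] _ _ tangent; case: a_action => _ _ aM _.
have a1 t : a t 1%g = 1%g.
  by apply: (mulgI (a t 1%g)); rewrite -aM !mulg1.
pose f t := Q (Ad (1%g, t) u).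
have fdird t : is_dird f t 1 0.
  have [Q1 _ Q0] := hQ; set w := Ad (1%g, t) u.
  have := Q1 _ _ _ _ _ (tangent 0 1 w).
  rewrite /= chart_inv1 Ad1 Q0 => H.
  (* Ad (1, t') u is Ad (1, t' - t) w, so the derivative at t is one at 0. *)
  have -> : f = (Q \o (fun p : g * R => Ad (chart_inv phi p.1, p.2) w)) \o
     (fun t' => (phi 1%g, t' - t)).
    apply/funext => t'; rewrite /f /w /= chart_inv1 -AdMul /semidirect_mul /=.
    by rewrite a1 mulg1 subrK.
  apply: (@is_dird_affine R R (g * R)%type R _ _ t 1 (0, 1)); last by rewrite subrr.
  by move=> h; congr pair; rewrite /= ?scaler0 ?addr0// addrAC.
have <- : Q (Ad (1%g, 0) u) = Q u by rewrite Ad1.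
apply: (@is_derive_0_is_cst _ f) => t.
have fE : (fun s : R => f (0 + s *: 1)) = f.
  by apply/funext => r; rewrite add0r scaler1.
have := @is_dird_derive R R f 0 1 t 0.
by rewrite fE add0r scaler1; apply.
Qed.

(** (h, s) is the product of (h, 0) and (1, s). *)
Lemma conserved_quantity_invariant h u : Q (Ad h u) = Q u.
Proof.
case: h => h s; case: hAd => -[_ AdMul] _ _ _; case: a_action => a0 _ _ _.
rewrite -(Q_R s u) -(QG h (Ad (1%g, s) u)) -AdMul /semidirect_mul/=.
by rewrite a0 mulg1 add0r.
Qed.

End Conservation.

(** * The Lorentzian form *)

Section Form.
Context {R : realType} {g : euclideanLieAlgebra R}.
Implicit Types (x y v : g) (u w : dext R g).

Lemma kappaDl x y v : kappa (x + y) v = kappa x v + kappa y v.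
Proof. exact: linearDl. Qed.

Lemma kappaDr x y v : kappa v (x + y) = kappa v x + kappa v y.
Proof. exact: linearDr. Qed.

Lemma kappaZl (r : R) x v : kappa (r *: x) v = r * kappa x v.
Proof. exact: linearZl_LR. Qed.

Lemma kappaZr (r : R) x v : kappa v (r *: x) = r * kappa v x.
Proof. exact: linearZr_LR. Qed.

Lemma kappaNl x v : kappa (- x) v = - kappa x v.
Proof. by rewrite -scaleN1r kappaZl mulN1r. Qed.

Lemma kappaNr x v : kappa v (- x) = - kappa v x.
Proof. by rewrite -scaleN1r kappaZr mulN1r. Qed.

Lemma kappa0l v : kappa 0 v = 0.
Proof. by rewrite -(scale0r 0) kappaZl mul0r. Qed.

Lemma kappa_ge0 x : 0 <= kappa x x.
Proof.
by have [->|/kappa_pos/ltW//] := eqVneq x 0; rewrite kappa0l.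
Qed.

Lemma kappa_eq0 x : kappa x x <= 0 -> x = 0.
Proof.
by move=> kx; apply/eqP; apply: contraTT kx => /kappa_pos; rewrite -ltNge.
Qed.

Definition kappaE := (kappaDl, kappaDr, kappaNl, kappaNr, kappaZl, kappaZr).

Lemma dext_form_cvg (T : Type) (F : set_system T) {FF : Filter F}
    (f f' : T -> dext R g) u w :
  f @ F --> u -> f' @ F --> w ->
  (fun t => dext_form (f t) (f' t)) @ F --> dext_form u w.
Proof.
move=> fu fw.
have c1 (E E' : tvsType R) (h : T -> E * E') (z : E * E') :
    h @ F --> z -> (fun t => (h t).1) @ F --> z.1.
  by move=> hz; exact: (cvg_comp _ _ hz (@tvs_fst_continuous _ E E' z)).
have c2 (E E' : tvsType R) (h : T -> E * E') (z : E * E') :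
    h @ F --> z -> (fun t => (h t).2) @ F --> z.2.
  by move=> hz; exact: (cvg_comp _ _ hz (@tvs_snd_continuous _ E E' z)).
have c11 (h : T -> dext R g) (z : dext R g) :
    h @ F --> z -> (fun t => (h t).1.1) @ F --> z.1.1.
  by move=> hz; exact/(c1 _ _ (fst \o h))/c1.
have c12 (h : T -> dext R g) (z : dext R g) :
    h @ F --> z -> (fun t => (h t).1.2) @ F --> z.1.2.
  by move=> hz; exact/(c2 _ _ (fst \o h))/c1.
apply: cvgB.
  by apply: cvgD; apply: cvgM; [exact: c11|exact: c2|exact: c2|exact: c11].
have fx : (fun t => ((f t).1.2, (f' t).1.2)) @ F --> (u.1.2, w.1.2).
  by apply: tvs_cvg_pair; exact: c12.
exact: (cvg_comp _ _ fx (@kappa_cont R g (u.1.2, w.1.2))).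
Qed.

Lemma dext_formDl u u' w : dext_form (u + u') w = dext_form u w + dext_form u' w.
Proof. by rewrite /dext_form /= kappaE; ring. Qed.
Lemma dext_formDr u u' w : dext_form w (u + u') = dext_form w u + dext_form w u'.
Proof. by rewrite /dext_form /= kappaE; ring. Qed.
Lemma dext_formZl (r : R) u w : dext_form (r *: u) w = r * dext_form u w.
Proof. by rewrite /dext_form /= kappaE /GRing.scale/=; ring. Qed.
Lemma dext_formZr (r : R) u w : dext_form w (r *: u) = r * dext_form w u.
Proof. by rewrite /dext_form /= kappaE /GRing.scale/=; ring. Qed.

(** The element (0, x, s) represents a tangent vector of the group; the
    terms in D cancel by skew-symmetry, and kappa ([x, y], y) = 0 by
    invariance. *)
Lemma dext_form_bracket (D : {linear g -> g}) : skew_derivation D ->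
  forall x (s : R) u, dext_form (dext_bracket D (0, x, s) u) u = 0.
Proof.
move=> [_ _ skew] x s [[z y] t]; rewrite /dext_form/= !kappaE.
have k1 : kappa (lie x y) y = 0 by rewrite kappa_inv lie_alt linear0r.
have k2 := skew y y; rewrite (kappa_sym y) in k2.
have k3 := skew x y.
have {}k2 : kappa (D y) y = 0 by lra.
have {}k3 : kappa (D x) y = - kappa x (D y) by lra.
by rewrite k1 k2 k3; ring.
Qed.

Lemma conserved_t (D : {linear g -> g}) :
  conserved_quantity D (fun u => u.2) (fun p => p.2.2).
Proof.
split=> //.
- move=> E f x v l fl; rewrite /is_dird.
  exact: (cvg_comp _ _ fl (@tvs_snd_continuous R (R * g)%type R l)).
- move=> p; apply: (@continuous_comp _ _ _ snd snd).
    exact: (@tvs_snd_continuous R (dext R g) (dext R g) p).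
  exact: (@tvs_snd_continuous R (R * g)%type R).
Qed.

Lemma conserved_form (D : {linear g -> g}) : skew_derivation D ->
  conserved_quantity D (fun u => dext_form u u)
    (fun p => dext_form p.2 p.1 + dext_form p.1 p.2).
Proof.
move=> hD; split.
- move=> E f x v l fl; rewrite /is_dird.
  have fx := is_dird_cvg fl.
  have H : (fun h =>
      dext_form (h^-1 *: (f (x + h *: v) - f x)) (f (x + h *: v)) +
      dext_form (f x) (h^-1 *: (f (x + h *: v) - f x))) @ (0:R)^' -->
      dext_form l (f x) + dext_form (f x) l.
    apply: cvgD; first exact: dext_form_cvg fl fx.
    exact: dext_form_cvg (cvg_cst (f x)) fl.
  set q := (X in X @ _); set q' := (X in X @ _) in H.
  suff -> : q = q' by [].
  apply/funext => h; rewrite /q /q' /= dext_formZl dext_formZr -mulrDr.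
  rewrite -!(scaleN1r (f x)) !dext_formDl !dext_formDr !dext_formZl !dext_formZr.
  by congr (_ * _); ring.
- move=> p; have H1 := @tvs_fst_continuous R (dext R g) (dext R g) p.
  have H2 := @tvs_snd_continuous R (dext R g) (dext R g) p.
  exact: (cvgD (dext_form_cvg H2 H1) (dext_form_cvg H1 H2)).
- move=> v s u; rewrite /= [X in _ + X](_ : _ =
      dext_form (dext_bracket D (0, v, s) u) u).
    by rewrite dext_form_bracket// addr0.
  by rewrite /dext_form kappa_sym; ring.
Qed.

End Form.

(** * The half space and the solid hyperboloids *)

Section HalfSpace.
Context {R : realType} {g : euclideanLieAlgebra R}.
Implicit Types (x y : g) (u w : dext R g).

Lemma dext_t_linear : linear (fun u : dext R g => u.2).
Proof. by []. Qed.

Lemma dext_t_continuous : continuous (fun u : dext R g => u.2).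
Proof. exact: (@tvs_snd_continuous R (R * g)%type R). Qed.

Lemma dext_form_continuous : continuous (fun u : dext R g => dext_form u u).
Proof. by move=> u; apply: (@dext_form_cvg R g _ (nbhs u)); exact: cvg_id. Qed.

Lemma OmegaE : Omega g = [set u : dext R g | 0 < u.2].
Proof.
apply/seteqP; split=> [_ [w [w2 _] [r _ <-]]|u u2] /=.
  by rewrite /GRing.scale/= mulr0 subr0.
(* Adding r c raises beta by 2 r t, here 2 (|beta (u, u)| + 1). *)
pose r := (`|dext_form u u| + 1) / u.2.
have r0 : 0 <= r by rewrite divr_ge0 ?addr_ge0// ltW.
exists (u + r *: dext_c); last by exists r => //; rewrite addrK.
split; first by rewrite /= /GRing.scale/= mulr0 addr0.
have -> : dext_form (u + r *: dext_c) (u + r *: dext_c) =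
    dext_form u u + 2 * (r * u.2).
  rewrite dext_formDl !dext_formDr !dext_formZl !dext_formZr.
  rewrite /dext_form /= kappa0l kappa_sym kappa0l; ring.
rewrite divfK ?gt_eqF//.
have := ler_norm (- dext_form u u); rewrite normrN.
have := normr_ge0 (dext_form u u); lra.
Qed.

Lemma gtildeE : gtilde g = [set u : dext R g | u.2 = 0].
Proof.
apply/seteqP; split=> [_ [r _ [x _ <-]]|[[z x] t] /= ->] /=.
  by rewrite addr0 /GRing.scale/= mulr0.
exists z => //; exists x => //.
by congr (_, _, _); rewrite /= ?scaler0 ?add0r ?addr0// /GRing.scale/= mulr1.
Qed.

Lemma gtilde_ideal (D : {linear g -> g}) : is_ideal D (gtilde g).
Proof.
rewrite gtildeE; split=> //= r u w u2 w2.
by rewrite u2 w2 /GRing.scale/= mulr0 addr0.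
Qed.

Lemma Omega_half_space : is_open_half_space_bounded_by (Omega g) (gtilde g).
Proof.
exists (fun u => u.2); split=> //.
- by split; [exact: dext_t_linear|exact: dext_t_continuous].
- by exists (0, 0, 1); rewrite /= oner_neq0.
- exact: OmegaE.
- exact: gtildeE.
Qed.

Lemma open_dist (T : topologicalType) (F : T -> R) (c r : R) : continuous F ->
  open [set u | `|F u - c| < r].
Proof.
move=> Fc; have -> : [set u | `|F u - c| < r] = F @^-1` (ball c r).
  by apply/seteqP; split => u /=; rewrite -ball_normE/= distrC.
by apply: open_comp => [u _|]; [exact: Fc|exact: ball_open].
Qed.

Lemma Omega_open : open (Omega g : set (dext R g)).
Proof.
rewrite OmegaE.
apply: (@open_comp _ _ (fun u : dext R g => u.2) [set t | 0 < t]).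
  by move=> u _; exact: dext_t_continuous.
exact: open_gt.
Qed.

(** On a hyperplane of constant t the form u |-> beta (u, u) is concave, and the
    defect is a multiple of kappa of the difference of the g-components: this
    gives at once convexity of the solid hyperboloids and the equality case. *)
Lemma dext_form_conv u w (s : R) : u.2 = w.2 ->
  dext_form (s *: u + (1 - s) *: w) (s *: u + (1 - s) *: w) =
  s * dext_form u u + (1 - s) * dext_form w w +
  s * (1 - s) * kappa (u.1.2 - w.1.2) (u.1.2 - w.1.2).
Proof.
case: u w => [[z x] t] [[z' x'] t'] /= ->.
rewrite !dext_formDl !dext_formDr !dext_formZl !dext_formZr /dext_form/= !kappaE.
rewrite (kappa_sym x'); ring.
Qed.

Definition solid_hyperboloid (t b : R) : set (dext R g) :=
  [set w | w.2 = t /\ b <= dext_form w w].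

Lemma solid_hyperboloid_convex t b : convex_set (solid_hyperboloid t b).
Proof.
move=> u w s; rewrite !inE => -[ut ub] [wt wb].
have s0 : 0 <= s%:num by exact: ge0.
have s1 : s%:num <= 1 by exact: le1.
rewrite /conv/= /unstable.onem; split.
  by rewrite /= ut wt /GRing.scale/=; ring.
rewrite dext_form_conv ?ut// .
have k0 := kappa_ge0 (u.1.2 - w.1.2).
have s1' : 0 <= 1 - s%:num by rewrite subr_ge0.
have := mulr_ge0 (mulr_ge0 s0 s1') k0.
have := ler_wpM2l s0 ub; have := ler_wpM2l s1' wb; lra.
Qed.

Lemma solid_hyperboloid_closed t b : closed (solid_hyperboloid t b).
Proof.
apply: closedI.
  apply: (@closed_comp _ _ (fun u : dext R g => u.2) [set s | s = t]).
    by move=> u _; exact: dext_t_continuous.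
  exact: closed_eq.
apply: (@closed_comp _ _ (fun u : dext R g => dext_form u u) [set s | b <= s]).
  by move=> u _; exact: dext_form_continuous.
exact: closed_ge.
Qed.

Lemma solid_hyperboloid_extreme u : u.2 != 0 ->
  extreme_points (solid_hyperboloid u.2 (dext_form u u)) u.
Proof.
move=> u0; split; first by split.
move=> y z s [yt yb] [zt zb] /andP[s0 s1] uE.
have := @dext_form_conv y z s; rewrite yt zt -uE => /(_ erefl) E.
have k0 := kappa_ge0 (y.1.2 - z.1.2).
have p : 0 < s * (1 - s) by rewrite mulr_gt0// subr_gt0.
(* beta (u, u) is at most both values whose convex combination, plus the defect,
   equals it: the defect vanishes and both values are beta (u, u). *)
have xE : y.1.2 - z.1.2 = 0 by apply: kappa_eq0; nra.
rewrite xE kappa0l in E.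
have {}yb : dext_form y y = dext_form u u by nra.
have {}zb : dext_form z z = dext_form u u by nra.
have yz : y = z.
  move/eqP: xE; rewrite subr_eq0 => /eqP xE.
  move: yb zb yt zt; rewrite /dext_form xE.
  case: y z xE {E k0 uE} => [[a x] t] [[a' x'] t'] /= -> E1 E2 E3 E4.
  rewrite E3 E4 in E1 E2 *; congr (_, _, _).
  by apply: (mulIf u0); lra.
have uy : u = y by rewrite uE -yz -scalerDl addrCA subrr addr0 scale1r.
by split; rewrite uy.
Qed.

Lemma extreme_points_sub (E : tvsType R) (A B : set E) (x : E) :
  B `<=` A -> B x -> extreme_points A x -> extreme_points B x.
Proof.
by move=> BA Bx [_ Aext]; split=> // y z s /BA Ay /BA Az; exact: Aext.
Qed.

End HalfSpace.

(** * Functionals continuous for the norm of kappa *)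

Section Functionals.
Context {R : realType} {g : euclideanLieAlgebra R}.
Implicit Types (x y : g) (u w : dext R g) (al : g -> R) (lam : dext R g -> R).

Lemma linear_fun0 (E : tvsType R) (f : E -> R) : linear f -> f 0 = 0.
Proof.
by move=> fl; have := fl 1 0 0; rewrite scaler0 addr0 /GRing.scale/=; lra.
Qed.

Lemma linear_funZ (E : tvsType R) (f : E -> R) : linear f ->
  forall r (x : E), f (r *: x) = r * f x.
Proof. by move=> fl r x; have := fl r x 0; rewrite linear_fun0// !addr0. Qed.

Lemma linear_funD (E : tvsType R) (f : E -> R) : linear f ->
  forall x y : E, f (x + y) = f x + f y.
Proof. by move=> fl x y; have := fl 1 x y; rewrite !scale1r. Qed.

Lemma linear_funB (E : tvsType R) (f : E -> R) : linear f ->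
  forall x y : E, f (x - y) = f x - f y.
Proof.
by move=> fl x y; rewrite linear_funD// -scaleN1r linear_funZ// mulN1r.
Qed.

Lemma kappa_normZ (r : R) x : kappa_norm (r *: x) = `|r| * kappa_norm x.
Proof.
by rewrite /kappa_norm !kappaE mulrA -expr2 sqrtrM ?sqr_ge0// sqrtr_sqr.
Qed.

Lemma kappa_norm_ge0 x : 0 <= kappa_norm x.
Proof. exact: sqrtr_ge0. Qed.

Lemma kappa_norm_sqr x : kappa_norm x ^+ 2 = kappa x x.
Proof. by rewrite sqr_sqrtr// kappa_ge0. Qed.

Lemma kappa_norm_eq0 x : kappa_norm x = 0 -> x = 0.
Proof.
by move=> nx; apply: kappa_eq0; rewrite -kappa_norm_sqr nx expr0n.
Qed.

Lemma kappa_continuous_bounded al : linear al -> kappa_continuous al ->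
  exists M, forall x, `|al x| <= M * kappa_norm x.
Proof.
move=> all /(_ 0 1 ltr01)[d d0 ald].
exists (2 / d) => x; have [nx|nx] := eqVneq (kappa_norm x) 0.
  by rewrite (kappa_norm_eq0 nx) linear_fun0// normr0 -(kappa_norm_eq0 nx) nx mulr0.
have nx0 : 0 < kappa_norm x by rewrite lt_neqAle eq_sym nx kappa_norm_ge0.
set r := d / 2 / kappa_norm x.
have r0 : 0 < r by rewrite !divr_gt0.
have := ald (r *: x); rewrite subr0 kappa_normZ (linear_fun0 all) subr0.
rewrite (linear_funZ all).
rewrite [X in _ -> X < _]normrM (gtr0_norm r0) {1}/r divfK//.
have dd : d / 2 < d by rewrite ltr_pdivrMr// ltr_pMr// ltr1n.
move=> /(_ dd) /ltW; rewrite -ler_pdivlMl// => /le_trans; apply.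
rewrite mulr1 le_eqVlt; apply/orP; left; apply/eqP; rewrite /r.
by field; rewrite nx gt_eqF.
Qed.

Lemma bounded_kappa_continuous al (C : R) : linear al ->
  (forall x, kappa x x <= 1 -> `|al x| <= C) -> kappa_continuous al.
Proof.
move=> all alC x e e0.
have C0 : 0 <= C by apply: le_trans (alC 0 _); rewrite ?normr_ge0// kappa0l ler01.
have C1 : 0 < C + 1 by rewrite ltr_wpDl.
pose d := e / (C + 1); have d0 : 0 < d by rewrite divr_gt0.
exists d => // y yx; rewrite -(linear_funB all).
have -> : y - x = d *: (d^-1 *: (y - x)) by rewrite scalerA divff ?gt_eqF// scale1r.
rewrite (linear_funZ all) normrM gtr0_norm//.
have : `|al (d^-1 *: (y - x))| <= C.
  apply: alC; rewrite -kappa_norm_sqr kappa_normZ gtr0_norm ?invr_gt0//.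
  rewrite expr_le1// ?mulr_ge0 ?kappa_norm_ge0 ?invr_ge0 ?ltW//.
  by rewrite ltr_pdivrMl// mulr1.
move=> /(ler_wpM2l (ltW d0)) /le_lt_trans; apply.
by rewrite /d mulrAC ltr_pdivrMr// ltr_pM2l// ltrDl.
Qed.

Lemma functional_decomp lam u : linear lam ->
  lam u = u.1.1 * lam dext_c + lam (0, u.1.2, 0) + u.2 * lam (0, 0, 1).
Proof.
move=> ll; rewrite -!(linear_funZ ll) -!(linear_funD ll); congr lam.
case: u => [[z x] t] /=; congr (_, _, _);
  rewrite /= ?scaler0 ?add0r ?addr0 /GRing.scale/= ?mulr1 ?mulr0 ?addr0 ?add0r//.
Qed.

Lemma restriction_linear lam : linear lam -> linear (fun x : g => lam (0, x, 0)).
Proof.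
move=> ll r x y; rewrite /= -ll; congr lam.
by congr (_, _, _); rewrite /= /GRing.scale/= ?mulr0 addr0.
Qed.

(** Eliminating z by means of beta (u, u) turns lam u into a quadratic
    polynomial in the norm of x, with positive leading coefficient
    c / (2 t), up to the error |alpha x| <= M |x|; its minimum is reached at the
    norm M t / c. The bound involves only t and beta (u, u), which are constant
    on orbits. *)
Lemma functional_lower_bound lam u (M : R) : linear lam ->
  (forall x, `|lam (0, x, 0)| <= M * kappa_norm x) ->
  0 < lam dext_c * u.2 ->
  lam dext_c * dext_form u u / (2 * u.2) + lam (0, 0, 1) * u.2
    - M ^+ 2 * u.2 / (2 * lam dext_c) <= lam u.
Proof.
move=> ll lM zt0; rewrite (functional_decomp u ll).
case: u zt0 => [[z x] t] /=; set c := lam dext_c; rewrite /dext_form /= => zt0.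
have c0 : c != 0 by apply: contraTneq zt0 => ->; rewrite mul0r ltxx.
have t0 : t != 0 by apply: contraTneq zt0 => ->; rewrite mulr0 ltxx.
have : - (M * kappa_norm x) <= lam (0, x, 0).
  by rewrite lerNl; apply: le_trans (lM x); rewrite -normrN ler_norm.
rewrite -kappa_norm_sqr; set N := kappa_norm x => lx.
have sq : 0 <= c / (2 * t) * (N - M * t / c) ^+ 2.
  rewrite mulr_ge0 ?sqr_ge0//.
  have -> : c / (2 * t) = (c * t) / (2 * t ^+ 2) by field.
  by rewrite divr_ge0 ?(ltW zt0)// mulr_ge0// sqr_ge0.
rewrite -subr_ge0.
have -> : z * c + lam (0, x, 0) + t * lam (0, 0, 1) -
   (c * (z * t + t * z - N ^+ 2) / (2 * t) + lam (0, 0, 1) * t -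
    M ^+ 2 * t / (2 * c)) =
   lam (0, x, 0) + M * N + c / (2 * t) * (N - M * t / c) ^+ 2.
  by field; rewrite c0 t0.
by rewrite addr_ge0//; lra.
Qed.

Lemma functional_upper_bound lam u (M : R) : linear lam ->
  (forall x, `|lam (0, x, 0)| <= M * kappa_norm x) ->
  lam dext_c * u.2 < 0 ->
  lam u <= lam dext_c * dext_form u u / (2 * u.2) + lam (0, 0, 1) * u.2
    - M ^+ 2 * u.2 / (2 * lam dext_c).
Proof.
move=> ll lM cu.
have nl : linear (fun u => - lam u).
  by move=> r x y; rewrite ll opprD /GRing.scale/= mulrN.
have := @functional_lower_bound (fun u => - lam u) u M nl.
rewrite /= mulNr oppr_gt0 => /(_ _ cu) H.
rewrite -lerN2; apply: le_trans (H _); last by move=> x; rewrite normrN.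
by rewrite le_eqVlt; apply/orP; left; apply/eqP; rewrite mulrN invrN; ring.
Qed.

(** The cone W contains all (1, x, 1) with kappa (x, x) <= 1, so positivity
    bounds alpha on the unit ball. *)
Lemma dual_cone_beta_dual : dual_cone (coneW g) `<=` beta_dual g.
Proof.
move=> lam [[ll lc] lW]; split => //.
apply: (@bounded_kappa_continuous _ (lam dext_c + lam (0, 0, 1))).
  exact: restriction_linear.
move=> x kx.
have half y : kappa y y <= 1 -> - lam (0, y, 0) <= lam dext_c + lam (0, 0, 1).
  move=> ky; have /lW : coneW g (1, y, 1).
    by split; rewrite /= ?ltr01// /dext_form/=; lra.
  rewrite (functional_decomp _ ll)/=; lra.
have := half x kx.
have := half (- x); rewrite !kappaE opprK => /(_ kx).
have := linear_funZ (restriction_linear ll) (-1) x; rewrite /= scaleN1r => ->.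
by rewrite mulN1r opprK ler_norml => ? ?; apply/andP; split; lra.
Qed.

End Functionals.

(** * Orbits of the adjoint action *)

Section Orbits.
Context {R : realType} {g : euclideanLieAlgebra R}.
Variables (D : {linear g -> g}) (hD : skew_derivation D).
Variables (G : lieGroup g) (hG : connected [set: G]).
Variables (a : R -> G -> G) (ha : smooth_aut_action a).
Variables (Ad : G * R -> dext R g -> dext R g) (hAd : adjoint_action D a Ad).

Lemma Ad_t h u : (Ad h u).2 = u.2.
Proof. exact: (conserved_quantity_invariant hAd (conserved_t D) ha hG). Qed.

Lemma Ad_form h u : dext_form (Ad h u) (Ad h u) = dext_form u u.
Proof. exact: (conserved_quantity_invariant hAd (conserved_form hD) ha hG). Qed.

Lemma Ad_continuous h : continuous (Ad h).
Proof.
case: hAd => _ _ [Adc _] _ u.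
have hu : (fun w => (h, w)) @ u --> ((h, u) : (G * R) * dext R g).
  apply: (@cvg_pair _ _ _ _ (nbhs h) (nbhs u)); first exact: cvg_cst.
  exact: cvg_id.
exact: (cvg_comp _ _ hu (Adc (h, u))).
Qed.

Lemma orbit_pt_refl u : orbit_pt Ad u u.
Proof. by exists (1%g, 0) => //; case: hAd => -[]. Qed.

Lemma orbit_pt_sub u :
  orbit_pt Ad u `<=` solid_hyperboloid u.2 (dext_form u u).
Proof. by move=> _ [h _ <-]; split; rewrite ?Ad_t ?Ad_form. Qed.

(** The hull lies in a solid hyperboloid of which u is an extreme point. *)
Lemma orbit_extreme u : u.2 != 0 ->
  extreme_points (closed_convex_hull (orbit_pt Ad u)) u.
Proof.
move=> u0; apply: (extreme_points_sub _ _ (solid_hyperboloid_extreme u0)).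
- rewrite /closed_convex_hull.
  have -> := (closure_id _).1 (@solid_hyperboloid_closed R g u.2 (dext_form u u)).
  apply: closure_subset; apply: smallest_sub.
    exact: solid_hyperboloid_convex.
  exact: orbit_pt_sub.
- apply: subset_closure; apply: sub_smallest (orbit_pt_refl u); exact: subset_refl.
Qed.

Lemma orbit_lower_bound lam u : beta_dual g lam -> 0 < lam dext_c * u.2 ->
  has_lbound (lam @` orbit_pt Ad u).
Proof.
move=> [[ll _] lk] cu.
have [M lM] := kappa_continuous_bounded (restriction_linear ll) lk.
exists (lam dext_c * dext_form u u / (2 * u.2) + lam (0, 0, 1) * u.2
    - M ^+ 2 * u.2 / (2 * lam dext_c)).
move=> _ [_ [h _ <-] <-].
rewrite -(Ad_t h) -(Ad_form h); apply: functional_lower_bound => //.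
by rewrite Ad_t.
Qed.

Lemma orbit_fun_dual (lam : dext R g -> R) : topological_dual _ lam ->
  orbit_fun Ad lam `<=` topological_dual _.
Proof.
move=> [ll lc] _ [h _ <-]; split.
  by move=> r u w /=; case: hAd => _ -> _ _; rewrite ll.
by move=> u; apply: continuous_comp; [exact: Ad_continuous|exact: lc].
Qed.

(** The bound of [functional_upper_bound] is locally uniform in u: the open
    set is a neighbourhood of (0, 0, - sg c) on which c t < 0, while t, 1 / t,
    beta (u, u) and lam u stay bounded. The last of them bounds the supremum
    from below, since lam belongs to its own orbit. *)
Lemma orbit_semi_equicontinuous lam : beta_dual g lam -> lam dext_c != 0 ->
  semi_equicontinuous (orbit_fun Ad lam).
Proof.
move=> [[ll lc] lk] c0; split; first exact: orbit_fun_dual.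
have [M lM] := kappa_continuous_bounded (restriction_linear ll) lk.
set c := lam dext_c in c0 *.
pose u0 : dext R g := (0, 0, - Num.sg c).
exists ([set u | `|u.2 - u0.2| < 2^-1] `&`
  ([set u | `|dext_form u u - dext_form u0 u0| < 1] `&`
   [set u | `|lam u - lam u0| < 1])); split.
- by apply: openI; [|apply: openI]; apply: open_dist => //;
    [exact: dext_t_continuous|exact: dext_form_continuous].
- by exists u0; rewrite /= !subrr normr0; split=> //; rewrite invr_gt0.
exists (`|c| + 2 * `|lam (0, 0, 1)| + M ^+ 2 / `|c| + `|lam u0| + 1).
move=> u [/= ut [uf ul]].
have u0f : dext_form u0 u0 = 0 by rewrite /dext_form/= kappa0l; ring.
rewrite u0f subr0 in uf.
have [ct t1 t2] : [/\ c * u.2 < 0, 1 <= 2 * `|u.2| & `|u.2| <= 2].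
  move: ut; rewrite /= opprK ltr_norml => /andP[].
  have [c_lt0|c_gt0|c_eq0] := ltgtP c 0; last by rewrite c_eq0 eqxx in c0.
  - rewrite ltr0_sg// => ut1 ut2; rewrite gtr0_norm; last by lra.
    by split; [rewrite nmulr_rlt0//|..]; lra.
  - rewrite gtr0_sg// => ut1 ut2; rewrite ltr0_norm; last by lra.
    by split; [rewrite pmulr_rlt0//|..]; lra.
have nc0 : 0 < `|c| by rewrite normr_gt0.
have t0 : 0 < `|u.2| by lra.
set N := (X in (_ <= X%:E)%E).
have lamN : - N <= lam u.
  have := ler_norm (- lam u0); rewrite normrN.
  move: ul; rewrite ltr_norml => /andP[ul1 _].
  have := normr_ge0 (lam (0, 0, 1)); have := normr_ge0 (lam u0).
  have : 0 <= M ^+ 2 / `|c| by rewrite divr_ge0 ?sqr_ge0.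
  rewrite /N; lra.
have orbitN h : lam (Ad h u) <= N.
  apply: (le_trans (functional_upper_bound ll lM _)); rewrite Ad_t// Ad_form -/c.
  have e1 : c * dext_form u u / (2 * u.2) <= `|c|.
    apply: (le_trans (ler_norm _)).
    rewrite !normrM normfV normrM (ger0_norm (_ : 0 <= 2))//.
    rewrite -mulrA ler_piMr// ler_pdivrMr ?mulr_gt0// mul1r.
    by apply: le_trans t1; exact: ltW.
  have e2 : lam (0, 0, 1) * u.2 <= 2 * `|lam (0, 0, 1)|.
    by apply: (le_trans (ler_norm _)); rewrite normrM mulrC ler_wpM2r.
  have e3 : - (M ^+ 2 * u.2 / (2 * c)) <= M ^+ 2 / `|c|.
    have -> : - (M ^+ 2 * u.2 / (2 * c)) = M ^+ 2 / c * (- u.2 / 2) by field.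
    apply: (le_trans (ler_norm _)); rewrite normrM !normf_div normrN.
    rewrite (ger0_norm (sqr_ge0 M)) (ger0_norm (_ : 0 <= 2))//.
    by rewrite ler_piMr ?divr_ge0 ?sqr_ge0// ler_pdivrMr// mul1r.
  have := normr_ge0 (lam u0); rewrite /N; lra.
have supN : (ereal_sup [set (f u)%:E | f in orbit_fun Ad lam] <= N%:E)%E.
  by apply: ge_ereal_sup => _ [_ [h _ <-] <-]; rewrite lee_fin; exact: orbitN.
have Nsup : ((- N)%:E <= ereal_sup [set (f u)%:E | f in orbit_fun Ad lam])%E.
  apply: (@le_trans _ _ (lam u)%:E); first by rewrite lee_fin.
  apply: ereal_sup_ubound; exists (lam \o Ad (1%g, 0)).
    by exists (1%g, 0).
  by congr (_%:E); rewrite /=; case: hAd => -[-> _].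
move: supN Nsup; case: ereal_sup => [s| |] //=.
by rewrite !lee_fin ler_norml => -> ->.
Qed.

End Orbits.

Theorem proposition7p2 (R : realType) (g : euclideanLieAlgebra R)
    (D : {linear g -> g}) (hD : skew_derivation D)
    (G : lieGroup g) (hG : connected [set: G])
    (a : R -> G -> G) (ha : smooth_aut_action a) (haD : generated_by a D)
    (Ad : G * R -> dext R g -> dext R g) (hAd : adjoint_action D a Ad) :
  [/\ (* (a) *)
      [/\ Omega g = [set u : dext R g | 0 < u.2],
          open (Omega g),
          invariant_set Ad (Omega g),
          is_ideal D (gtilde g) &
          is_open_half_space_bounded_by (Omega g) (gtilde g)],
      (* (b) *)
      forall u : dext R g, Omega g u ->
        extreme_points (closed_convex_hull (orbit_pt Ad u)) u,
      (* (c) *)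
      forall (zs : R) (al : g -> R) (ts : R) (z : R) (x : g) (t : R),
        beta_dual g (dext_functional zs al ts) -> 0 < zs -> 0 < t ->
        dext_functional zs al ts @` orbit_pt Ad (z, x, t) =
          [set mu (z, x, t) | mu in orbit_fun Ad (dext_functional zs al ts)] /\
        has_lbound (dext_functional zs al ts @` orbit_pt Ad (z, x, t)),
      (* (d) *)
      dual_cone (coneW g) `<=` beta_dual g &
      (* (e) *)
      forall lam : dext R g -> R, beta_dual g lam -> lam dext_c != 0 ->
        semi_equicontinuous (orbit_fun Ad lam)].
Proof.
split.
- split.
  + exact: OmegaE.
  + exact: Omega_open.
  + by move=> h u; rewrite OmegaE /= (Ad_t hG ha hAd).
  + exact: gtilde_ideal.
  + exact: Omega_half_space.
- move=> u; rewrite OmegaE /= => u0.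
  by apply: (orbit_extreme hD hG ha hAd); rewrite gt_eqF.
- move=> zs al ts z x t bd zs0 t0; split.
    by rewrite image_comp /orbit_fun /orbit_pt image_comp.
  apply: (orbit_lower_bound hD hG ha hAd bd) => /=.
  rewrite mulr_gt0//.
  have [[ll _] _] := bd.
  have al0 : al 0 = 0.
    have := linear_fun0 ll; rewrite /dext_functional /=; lra.
  by rewrite /dext_functional /= al0; lra.
- exact: dual_cone_beta_dual.
- exact: (orbit_semi_equicontinuous hD hG ha hAd).
Qed.
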